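(* Let $X$ be a compact Hausdorff space equipped with a continuous action of an amenable group $G$. Suppose that $X$ has more than one point and that the action of $G$ on $X$ has the weak specification property. Then $h_{\mathrm{top}}(X,G) > 0$.
   Context: An action of a group $G$ on a topological space $X$ is continuous if $x \mapsto gx$ is continuous for every $g \in G$. A compact Hausdorff space $X$ is regarded as a uniform space with its unique compatible uniform structure, whose entourages are the neighborhoods of the diagonal in $X \times X$. A group $G$ is amenable if there is a left Følner net, i.e. a net $(F_j)_{j\in J}$ of nonempty finite subsets of $G$ with $\lim_j |gF_j \setminus F_j|/|F_j| = 0$ for all $g \in G$. Weak specification property: for every entourage $U$ of $X$ there is a finite subset $\Lambda \subset G$ such that for every finite sequence $\Omega_1,\dots,\Omega_n$ ($n\ge 1$) of finite subsets of $G$ with $\Omega_j \cap \Lambda\Omega_k = \varnothing$ for all distinct $j,k$, and every sequence $x_1,\dots,x_n$ of points of $X$, there is $x \in X$ with $(gx,gx_i) \in U$ for all $g \in \Omega_i$ and $1 \le i \le n$. Topological entropy: for a finite open cover $\alpha$ of $X$, $N(\alpha)$ is the minimal cardinality of a subcover of $\alpha$. For a finite subset $F \subset G$, $\alpha^{(F)} = \bigvee_{g \in F} g^{-1}\alpha$, where $g^{-1}\alpha = \{g^{-1}A : A \in \alpha\}$ and $\alpha \vee \beta = \{A \cap B : A \in \alpha, B \in \beta\}$. Put $h_{\mathrm{top}}(X,G,\alpha) = \lim_{j} \frac{\log N(\alpha^{(F_j)})}{|F_j|}$ for a left Følner net $(F_j)$ of $G$ (the limit exists and does not depend on the net, by the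 Ornstein–Weiss lemma), and $h_{\mathrm{top}}(X,G) = \sup_\alpha h_{\mathrm{top}}(X,G,\alpha)$ over all finite open covers $\alpha$ of $X$. *)

(* Defs.v *)
From HB Require Import structures.
From mathcomp Require Import all_boot all_order all_algebra finmap.
From mathcomp Require Import all_classical all_reals all_analysis.

Set Implicit Arguments.
Unset Strict Implicit.
Unset Printing Implicit Defensive.

Import Order.TTheory GRing.Theory Num.Theory.
Import numFieldNormedType.Exports.

Local Open Scope classical_set_scope.
Local Open Scope ring_scope.
Local Open Scope fset_scope.

Record continuous_action (G : groupType) (X : topologicalType) :=
  ContinuousAction {
    act_fun :> G -> X -> X;
    act_one : forall x : X, act_fun 1%g x = x;
    act_mul : forall (g h : G) (x : X),
      act_fun (g * h)%g x = act_fun g (act_fun h x);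
    act_continuous : forall g : G, continuous (act_fun g)
  }.

Definition fset_lmul (G : groupType) (g : G) (F : {fset G}) : {fset G} :=
  [fset (g * x)%g | x in F].

Definition fset_mul (G : groupType) (A B : {fset G}) : {fset G} :=
  [fset (a * b)%g | a in A, b in B].

(* A net is a map out of a nonempty preordered set in which any two elements
   have an upper bound; it converges to l when it does so along [tails le]. *)
Definition directed (J : Type) (le : J -> J -> Prop) : Prop :=
  [/\ inhabited J,
      forall i, le i i,
      forall i j k, le i j -> le j k -> le i k &
      forall i j, exists k, le i k /\ le j k].

Definition tails (J : Type) (le : J -> J -> Prop) : set_system J :=
  [set A | exists i, forall j, le i j -> A j].

Record left_folner_net (R : realType) (G : groupType) := LeftFolnerNet {
  folner_index : Type;
  folner_le : folner_index -> folner_index -> Prop;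
  folner_directed : directed folner_le;
  folner_fset :> folner_index -> {fset G};
  folner_nonempty : forall j, folner_fset j != fset0;
  folner_cvg : forall g : G,
    (#|` fset_lmul g (folner_fset j) `\` folner_fset j |%:R
       / #|` folner_fset j |%:R : R)
    @[j --> tails folner_le] --> (0 : R)
}.

Definition amenable (R : realType) (G : groupType) : Prop :=
  inhabited (left_folner_net R G).

(* The entourages of the unique uniform structure compatible with the topology
   when X is compact Hausdorff: the neighborhoods of the diagonal. *)
Definition diag_entourage (X : topologicalType) : set_system (X * X) :=
  set_nbhs [set xy : X * X | xy.1 = xy.2].

Definition weak_specification (G : groupType) (X : topologicalType)
    (a : continuous_action G X) : Prop :=
  forall U : set (X * X), diag_entourage U ->
  exists Lambda : {fset G},
  forall (n : nat) (Omega : 'I_n -> {fset G}) (x : 'I_n -> X),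
    (1 <= n)%N ->
    (forall j k : 'I_n, j != k ->
       Omega j `&` fset_mul Lambda (Omega k) = fset0) ->
  exists y : X, forall (i : 'I_n) (g : G), g \in Omega i ->
    U (a g y, a g (x i)).

Definition is_cover (X : Type) (alpha : {fset set X}) : Prop :=
  (\bigcup_(A in [set` alpha]) A = [set: X])%classic.

Definition finite_open_cover (X : topologicalType) (alpha : {fset set X}) :
    Prop :=
  (forall A, A \in alpha -> open A) /\ is_cover alpha.

(* When [alpha] is a cover it is one of the subcovers [beta], so the default
   value [#|` alpha|] does not alter the minimum. *)
Definition cover_number (X : Type) (alpha : {fset set X}) : nat :=
  \big[minn/#|` alpha|]_(beta <- fpowerset alpha | `[< is_cover beta >])
    #|` beta|.

Definition cover_join (X : Type) (alpha beta : {fset set X}) :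
    {fset set X} :=
  [fset (A `&` B)%classic | A in alpha, B in beta].

(* [g^-1 A] is the preimage of [A] under the bijection [x |-> g x]. *)
Definition cover_pull (G : groupType) (X : topologicalType)
    (a : continuous_action G X) (g : G) (alpha : {fset set X}) :
    {fset set X} :=
  [fset a g @^-1` A | A in alpha].

(* The trivial cover [{X}] is neutral for the join. *)
Definition cover_iter (G : groupType) (X : topologicalType)
    (a : continuous_action G X) (alpha : {fset set X}) (F : {fset G}) :
    {fset set X} :=
  \big[@cover_join X/[fset [set: X]]]_(g <- F) cover_pull a g alpha.

(* [lim] is total.  By the Ornstein-Weiss lemma the limit exists and does not
   depend on the net [F]. *)
Definition htop_cover (R : realType) (G : groupType) (X : topologicalType)
    (F : left_folner_net R G) (a : continuous_action G X)
    (alpha : {fset set X}) : R :=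
  lim ((ln (cover_number (cover_iter a alpha (F j)))%:R / #|` F j|%:R : R)
         @[j --> tails (@folner_le R G F)]).

Definition htop (R : realType) (G : groupType) (X : topologicalType)
    (F : left_folner_net R G) (a : continuous_action G X) : \bar R :=
  ereal_sup [set (htop_cover F a alpha)%:E
            | alpha in [set alpha | finite_open_cover alpha]].

(* Main.v *)
(* By the specification property, two disjoint closed neighborhoods of distinct
   points can be visited in an arbitrary pattern along any [Lambda]-separated
   subset of [F], and [F] contains such a subset of size proportional to [|F|].
   For the cover [alpha] by the two complements, [log N(alpha^(F))] therefore
   grows at least linearly in [|F|].

   As [lim] is total, positivity also needs the convergence of
   [h(F_j)/|F_j|], [h(F) = log N(alpha^(F))], that is, the Ornstein-Weiss
   lemma.  The limit is the infimum [s*] of the [s] such that [h(D) <= s|D|]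
   for all sufficiently invariant [D].  If [h(F_j)/|F_j|] stayed below [s*] by a
   fixed amount for arbitrarily large [j], then filling a fixed proportion of
   an invariant [D] by almost disjoint translates of one such [F_j] would
   improve an [s] close to [s*] to a bound smaller than [s*]. *)

Require Import Defs.
From mathcomp Require Import all_boot all_order all_algebra finmap.
From mathcomp Require Import all_classical all_reals all_analysis.
From mathcomp Require Import ring lra.

Set Implicit Arguments.
Unset Strict Implicit.
Unset Printing Implicit Defensive.

Import Order.TTheory GRing.Theory Num.Theory.
Import numFieldNormedType.Exports.

Local Open Scope classical_set_scope.
Local Open Scope fset_scope.
Local Open Scope ring_scope.

(** * Translates of finite subsets of a group *)

Definition fset_rmul (G : groupType) (F : {fset G}) (c : G) : {fset G} :=
  [fset (x * c)%g | x in F].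

Lemma in_fset_lmul (G : groupType) (g x : G) (F : {fset G}) :
  (x \in fset_lmul g F) = ((g^-1 * x)%g \in F).
Proof.
apply/imfsetP/idP => [[y /= yF ->]|xF]; first by rewrite mulKg.
by exists (g^-1 * x)%g => //=; rewrite mulVKg.
Qed.

Lemma in_fset_rmul (G : groupType) (c x : G) (F : {fset G}) :
  (x \in fset_rmul F c) = ((x * c^-1)%g \in F).
Proof.
apply/imfsetP/idP => [[y /= yF ->]|xF]; first by rewrite mulgK.
by exists (x * c^-1)%g => //=; rewrite mulgVK.
Qed.

Lemma card_fset_lmul (G : groupType) (g : G) (F : {fset G}) :
  #|` fset_lmul g F| = #|` F|.
Proof. by rewrite card_imfset //; exact: mulgI. Qed.

Lemma card_fset_rmul (G : groupType) (c : G) (F : {fset G}) :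
  #|` fset_rmul F c| = #|` F|.
Proof. by rewrite card_imfset //; exact: mulIg. Qed.

Lemma card_fset_lmulD (G : groupType) (g : G) (F : {fset G}) :
  #|` F `\` fset_lmul g F| = #|` fset_lmul g F `\` F|.
Proof. by rewrite !cardfsD card_fset_lmul fsetIC. Qed.

Lemma card_fset_filter (K : choiceType) (A : {fset K}) (p : pred K) :
  #|` [fset x in A | p x]| = (\sum_(x <- A) p x)%N.
Proof.
rewrite card_fset_sum1 -big_fset_condE big_mkcond /=.
by apply: eq_bigr => x _; case: (p x).
Qed.

Lemma card_rmulI_sum (G : groupType) (T U : {fset G}) (c : G) :
  #|` fset_rmul T c `&` U| = (\sum_(t <- T) ((t * c)%g \in U))%N.
Proof.
rewrite -card_fset_filter -[RHS](card_fset_rmul c); congr (#|` _|).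
by apply/fsetP => x; rewrite !(inE, in_fset_rmul) /= mulgVK.
Qed.

(** * Packings by almost disjoint right translates *)

Inductive packed (R : realType) (G : groupType) (eps : R) (T : {fset G}) :
    nat -> {fset G} -> Prop :=
| packed0 : packed eps T 0 fset0
| packedS m U c : packed eps T m U ->
    (#|` fset_rmul T c `&` U|%:R <= eps * #|` T|%:R) ->
    packed eps T m.+1 (fset_rmul T c `|` U).

(** Each added translate overlaps the earlier ones in at most [eps * |T|] points, so it brings at
    least [(1 - eps) * |T|] new ones. *)
Lemma packed_card (R : realType) (G : groupType) (eps : R) (T U : {fset G})
    (m : nat) :
  packed eps T m U -> (1 - eps) * (m%:R * #|` T|%:R) <= #|` U|%:R.
Proof.
elim=> [|{}m {}U c _ IH overlap]; first by rewrite mul0r mulr0 cardfs0.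
have /(congr1 (fun n => n%:R : R)) := cardfsUI (fset_rmul T c) U.
rewrite /= !natrD card_fset_rmul -natr1; lra.
Qed.

(** Left and right translations commute, so a point of [U] outside [k U] lies in [(T \ k T) c] for
    some translate [T c] of the packing; each translate contributes at most [|T \ k T| = |k T \ T|]
    points. *)
Lemma packed_boundary (R : realType) (G : groupType) (eps : R)
    (T U : {fset G}) (m : nat) (k : G) :
  packed eps T m U ->
  (#|` U `\` fset_lmul k U| <= m * #|` fset_lmul k T `\` T|)%N.
Proof.
elim=> [|{}m {}U c _ IH _]; first by rewrite fset0D cardfs0.
have sub : (fset_rmul T c `|` U) `\` fset_lmul k (fset_rmul T c `|` U)
    `<=` fset_rmul (T `\` fset_lmul k T) c `|` (U `\` fset_lmul k U).
  apply/fsubsetP => x; rewrite !(inE, in_fset_lmul, in_fset_rmul) -mulgA.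
  by do ![case: (_ \in _)].
apply: leq_trans (fsubset_leq_card sub) _; rewrite cardfsU.
apply: leq_trans (leq_subr _ _) _; rewrite mulSn leq_add//.
by rewrite card_fset_rmul card_fset_lmulD.
Qed.

Lemma packed_subadditive (R : realType) (G : groupType) (eps : R)
    (h : {fset G} -> R) (T U : {fset G}) (m : nat) :
  h fset0 <= 0 ->
  (forall A B, h (A `|` B) <= h A + h B) ->
  (forall A c, h (fset_rmul A c) <= h A) ->
  packed eps T m U -> h U <= m%:R * h T.
Proof.
move=> h0 h_sub h_rmul; elim=> [|{}m {}U c _ IH _]; first by rewrite mul0r.
rewrite -natr1 mulrDl mul1r addrC.
by apply: le_trans (h_sub _ _) _; rewrite lerD.
Qed.

Definition almost_invariant (R : realType) (G : groupType) (K : {fset G})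
    (delta : R) (D : {fset G}) : Prop :=
  forall k, k \in K -> #|` fset_lmul k D `\` D|%:R <= delta * #|` D|%:R.

(* A packing of maximal size meets every translate [T c] contained in [D] in
   at least [eps |T|] points; count the incidences [t c \in U]. *)
Lemma exists_packing (R : realType) (G : groupType) (eps delta : R)
    (T D : {fset G}) :
  0 < eps < 1 -> T != fset0 -> #|` T|%:R * delta <= 2^-1 ->
  almost_invariant T delta D ->
  exists m U, [/\ packed eps T m U, U `<=` D &
    eps / 2 * #|` D|%:R <= #|` U|%:R].
Proof.
move=> /andP[eps0 eps1] T0 Tdelta invD.
have cT0 : 0 < #|` T|%:R :> R by rewrite ltr0n cardfs_gt0.
pose p n := `[< exists m U, [/\ packed eps T m U, U `<=` D & #|` U| = n] >].
have p0 : exists n, p n.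
  by exists 0%N; apply/asboolP; exists 0%N, fset0; split => //; constructor.
have pD n : p n -> (n <= #|` D|)%N.
  by move=> /asboolP[m [U [_ UD <-]]]; exact: fsubset_leq_card.
case: (ex_maxnP p0 pD) => _ /asboolP[m [U [pU UD <-]]] Umax.
exists m, U; split => //.
pose P := [fset c in D | [forall t : T, (fsval t * c)%g \in D]].
have PD c : c \in P -> fset_rmul T c `<=` D.
  rewrite !inE /= => /andP[_ /forallP TcD].
  apply/fsubsetP => x; rewrite in_fset_rmul => xT.
  by have := TcD [` xT]; rewrite mulgVK.
(* Otherwise [T c] could be added to the packing, and since [eps < 1] and [T] is nonempty the union
   would grow, against maximality. *)
have meets c : c \in P -> eps * #|` T|%:R <= #|` fset_rmul T c `&` U|%:R.
  move=> cP; rewrite leNgt; apply/negP => /ltW small.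
  have pU' := packedS pU small.
  have /Umax : p #|` fset_rmul T c `|` U|.
    apply/asboolP; exists m.+1, (fset_rmul T c `|` U); split => //.
    by rewrite fsubUset PD.
  rewrite -(ler_nat R).
  have /(congr1 (fun n => n%:R : R)) := cardfsUI (fset_rmul T c) U.
  rewrite /= !natrD card_fset_rmul; nra.
(* For fixed [t], left translation by [t] maps the [c] with [t c] in [U] injectively into [U]. *)
have incidences : (\sum_(c <- P) #|` fset_rmul T c `&` U|
    <= #|` T| * #|` U|)%N.
  under eq_bigr do rewrite card_rmulI_sum.
  rewrite exchange_big /= card_fset_sum1 big_distrl /=.
  rewrite leq_sum// => t _; rewrite mul1n -card_fset_filter.
  rewrite -(card_fset_lmul t); apply: fsubset_leq_card; apply/fsubsetP => x.
  by rewrite in_fset_lmul !inE /= mulVKg => /andP[].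
have lower : #|` P|%:R * (eps * #|` T|%:R)
    <= (\sum_(c <- P) #|` fset_rmul T c `&` U|)%N%:R.
  rewrite natr_sum card_fset_sum1 natr_sum mulr_suml.
  by rewrite !big_seq ler_sum// => c cP; rewrite mul1r meets.
have PU : #|` P|%:R * eps <= #|` U|%:R.
  move: incidences; rewrite -(ler_nat R) natrM => /(le_trans lower).
  by rewrite mulrA mulrC ler_pM2l.
(* As [|T| * delta <= 1/2], this leaves at least half of [D] in [P], whence the factor [eps / 2]. *)
suff : #|` D|%:R <= #|` P|%:R + #|` T|%:R * (delta * #|` D|%:R).
  move=> DP; have := ler_wpM2r (ler0n R #|` D|) Tdelta.
  rewrite -mulrA => half; apply: le_trans PU.
  have : #|` D|%:R / 2 <= #|` P|%:R :> R by lra.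
  by move/(ler_wpM2l (ltW eps0)); lra.
(* A point of [D] outside [P] is moved out of [D] by some [t] in [T]; translated by [t], it falls in
   [t D \ D], which is small by invariance. *)
have subD : D `<=` P `|` \bigcup_(t <- T) (D `\` fset_lmul t^-1%g D).
  apply/fsubsetP => x xD; rewrite inE; case: (boolP (x \in P)) => //=.
  rewrite !inE xD /= => /forallPn[[t tT] /= txD].
  apply/bigfcupP; exists t; first by rewrite tT.
  by rewrite !(inE, in_fset_lmul) invgK txD.
have cardU : (#|` \bigcup_(t <- T) (D `\` fset_lmul t^-1%g D)|
    <= \sum_(t <- T) #|` fset_lmul t D `\` D|)%N.
  elim/big_rec2 : _ => [|t n B _ IH]; first by rewrite cardfs0.
  rewrite cardfsU; apply: leq_trans (leq_subr _ _) _; rewrite leq_add//.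
  rewrite -(card_fset_lmul t); apply: fsubset_leq_card; apply/fsubsetP => x.
  by rewrite !(inE, in_fset_lmul) invgK mulVKg.
apply: (@le_trans _ _ (#|` P|%:R +
    (\sum_(t <- T) #|` fset_lmul t D `\` D|)%N%:R)).
  rewrite -natrD ler_nat; apply: leq_trans (fsubset_leq_card subD) _.
  by rewrite cardfsU; apply: leq_trans (leq_subr _ _) _; rewrite leq_add2l.
rewrite lerD2l natr_sum card_fset_sum1 natr_sum mulr_suml.
by rewrite !big_seq ler_sum// => t tT; rewrite mul1r invD.
Qed.

(** * Asymptotic linear bounds and their improvement *)

Definition asymptotic_bound (R : realType) (G : groupType)
    (h : {fset G} -> R) (s : R) : Prop :=
  exists K (delta : R), 0 < delta /\ forall D : {fset G}, D != fset0 ->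
    almost_invariant K delta D -> h D <= s * #|` D|%:R.

(* Pack [D] by translates of a very invariant [T] with small [h T / |T|]: the
   packed part has at least [eps/2] of the mass of [D]; the rest is either
   negligible or still invariant enough for the bound [s] to apply to it. *)
Lemma asymptotic_bound_improve (R : realType) (G : groupType)
    (h : {fset G} -> R) (C s mu eps eta : R) :
  (forall A B, h (A `|` B) <= h A + h B) ->
  (forall A c, h (fset_rmul A c) <= h A) ->
  (forall A, h A <= C * #|` A|%:R) ->
  0 <= C -> 0 <= mu -> mu < s -> 0 < eps <= 2^-1 -> 0 < eta ->
  (forall K (delta : R), 0 < delta -> exists T, [/\ T != fset0,
     almost_invariant K delta T & h T <= (1 - eps) * mu * #|` T|%:R]) ->
  asymptotic_bound h s ->
  asymptotic_bound h (Num.max (s - eps / 2 * (s - mu)) (mu + C * eta)).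
Proof.
move=> h_sub h_rmul h_lin C0 mu0 mus /andP[eps0 eps_half] eta0 smallT.
move=> [K [delta [delta0 Kbound]]].
have h0 : h fset0 <= 0 by rewrite (le_trans (h_lin _))// cardfs0 mulr0.
(* The boundary of [D \ U] will receive one share [delta * eta / 3 * |D|] from [D] and two from the
   packing, because [m * |T| <= 2 * |U|] when [eps <= 1/2]. *)
have d1 : 0 < delta * eta / 3 by rewrite !mulr_gt0.
have [T [T0 invT hT]] := smallT K _ d1.
have cT0 : 0 < #|` T|%:R :> R by rewrite ltr0n cardfs_gt0.
(* Invariance under [K] serves the remainder [D \ U]; invariance under [T] up to [1 / (2 |T|)] is
   what the packing requires. *)
exists (K `|` T), (Num.min (delta * eta / 3) (2 * #|` T|%:R)^-1); split.
  by rewrite lt_min d1 invr_gt0 mulr_gt0.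
move=> D D0 invD.
have cD0 : 0 < #|` D|%:R :> R by rewrite ltr0n cardfs_gt0.
have [m [U [pU UD largeU]]] : exists m U, [/\ packed eps T m U, U `<=` D &
    eps / 2 * #|` D|%:R <= #|` U|%:R].
  apply: (@exists_packing _ _ eps (2 * #|` T|%:R)^-1) => //.
  - by rewrite eps0/=; lra.
  - by rewrite invfM mulrCA divff ?mulr1// gt_eqF.
  - move=> t tT; apply: le_trans (invD t _) _; first by rewrite inE tT orbT.
    by rewrite ler_pM2r// ge_min lexx orbT.
have mT := packed_card pU.
(* The factor [1 - eps] in the bound on [h T] cancels the loss from overlaps in [packed_card]. *)
have hU : h U <= mu * #|` U|%:R.
  apply: le_trans (packed_subadditive h0 h_sub h_rmul pU) _.
  apply: le_trans (ler_wpM2l (ler0n _ m) hT) _.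
  by move: (ler_wpM2l mu0 mT); lra.
have cD : #|` D `\` U|%:R = #|` D|%:R - #|` U|%:R :> R.
  by rewrite cardfsDS// natrB// fsubset_leq_card.
have hD : h D <= mu * #|` U|%:R + h (D `\` U).
  have {1}-> : D = U `|` (D `\` U).
    by rewrite fsetUDl fsetDv fsetD0; apply/esym/fsetUidPr.
  by rewrite (le_trans (h_sub _ _))// lerD2r.
rewrite maxr_pMl// le_max.
case: (lerP (#|` D `\` U|%:R) (eta * #|` D|%:R)) => [small|large].
  apply/orP; right; apply: le_trans hD _.
  have hR := le_trans (h_lin _) (ler_wpM2l C0 small).
  have : #|` U|%:R <= #|` D|%:R :> R by rewrite ler_nat fsubset_leq_card.
  by move=> /(ler_wpM2l mu0); lra.
apply/orP; left; apply: le_trans hD _.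
have : h (D `\` U) <= s * #|` D `\` U|%:R.
  apply: Kbound.
    by rewrite -cardfs_gt0 -(ltr0n R) (lt_trans _ large)// mulr_gt0.
  move=> k kK.
  (* A point of [k (D \ U)] outside [D \ U] either leaves [D], or lies in [U] but not in [k U]. *)
  have bU : (#|` fset_lmul k (D `\` U) `\` (D `\` U)| <=
     #|` fset_lmul k D `\` D| + #|` U `\` fset_lmul k U|)%N.
    apply: leq_trans (leq_subr #|` (fset_lmul k D `\` D) `&`
      (U `\` fset_lmul k U)| _).
    rewrite -cardfsU; apply: fsubset_leq_card.
    apply/fsubsetP => x; rewrite !(inE, in_fset_lmul).
    by do ![case: (_ \in _)].
  have := leq_trans bU (leq_add (leqnn _) (packed_boundary k pU)).
  rewrite -(ler_nat R) natrD natrM => /le_trans; apply.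
  have kD : #|` fset_lmul k D `\` D|%:R <= delta * eta / 3 * #|` D|%:R.
    apply: le_trans (invD k _) _; first by rewrite inE kK.
    by rewrite ler_pM2r// ge_min lexx.
  have kT := ler_wpM2l (ler0n _ m) (invT k kK).
  have mT2 : m%:R * #|` T|%:R <= 2 * #|` U|%:R :> R.
    have : 0 <= m%:R * #|` T|%:R :> R by rewrite mulr_ge0.
    move: mT; nra.
  have := ler_wpM2l (ltW d1) mT2.
  have UD' : #|` U|%:R <= #|` D|%:R :> R.
    by rewrite ler_nat fsubset_leq_card.
  have := ler_wpM2l (ltW d1) UD'.
  have := ler_wpM2l (ltW delta0) (ltW large).
  lra.
(* The total is now at most [s * |D| - (s - mu) * |U|], and [|U| >= eps / 2 * |D|]. *)
rewrite cD.
have smu0 : 0 <= s - mu by lra.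
have := ler_wpM2l smu0 largeU; lra.
Qed.

(** * Folner nets and the Ornstein-Weiss lemma *)

Lemma tails_filter (J : Type) (le : J -> J -> Prop) :
  directed le -> ProperFilter (tails le).
Proof.
move=> [[j0] refl trans up]; apply: Build_ProperFilter_ex.
  by move=> P [i Pi]; exists i; exact: Pi.
split.
- by exists j0.
- move=> P Q [i Pi] [j Qj]; have [k [ik jk]] := up i j.
  by exists k => l kl; split; [apply/Pi/(trans _ k)|apply/Qj/(trans _ k)].
- by move=> P Q PQ [i Pi]; exists i => j /Pi /PQ.
Qed.

Lemma folner_filter (R : realType) (G : groupType) (F : left_folner_net R G) :
  ProperFilter (tails (@folner_le R G F)).
Proof. exact/tails_filter/folner_directed. Qed.

#[local] Existing Instance folner_filter.

Lemma folner_card_gt0 (R : realType) (G : groupType) (F : left_folner_net R G)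
    (j : folner_index F) :
  0 < #|` F j|%:R :> R.
Proof. by rewrite ltr0n cardfs_gt0 folner_nonempty. Qed.

Lemma folner_almost_invariant (R : realType) (G : groupType)
    (F : left_folner_net R G) (K : {fset G}) (delta : R) :
  0 < delta ->
  \forall j \near tails (@folner_le R G F), almost_invariant K delta (F j).
Proof.
move=> delta0; elim/finSet_rect: K => K IH.
have [->|[k kK]] := fset_0Vmem K; first by near=> j => k; rewrite inE.
have := IH _ (fproperD1 kK).
have /cvgr0Pnorm_lt /(_ _ delta0) := @folner_cvg R G F k.
apply: filterS2 => j; rewrite ger0_norm ?divr_ge0//.
rewrite ltr_pdivrMr ?folner_card_gt0// => /ltW kj Kj l lK.
by have [->//|lk] := eqVneq l k; apply: Kj; rewrite !inE lk.
Unshelve. all: by end_near.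
Qed.

Lemma ornstein_weiss (R : realType) (G : groupType) (F : left_folner_net R G)
    (h : {fset G} -> R) (C : R) :
  (forall A B, h (A `|` B) <= h A + h B) ->
  (forall A c, h (fset_rmul A c) <= h A) ->
  (forall A, 0 <= h A) ->
  (forall A, h A <= C * #|` A|%:R) ->
  cvg (h (F j) / #|` F j|%:R @[j --> tails (@folner_le R G F)]).
Proof.
move=> h_sub h_rmul h_ge0 h_lin.
pose S : set R := asymptotic_bound h.
have S_ge0 s : S s -> 0 <= s.
  move=> [K [delta [delta0 bound]]].
  have [j invj] := filter_ex (folner_almost_invariant F K delta0).
  have := le_trans (h_ge0 _) (bound _ (folner_nonempty j) invj).
  by rewrite pmulr_lge0// folner_card_gt0.
have SC : S C by exists fset0, 1; split.
have C0 := S_ge0 _ SC.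
have lbS : has_lbound S by exists 0; exact: S_ge0.
have infS : has_inf S by split=> //; exists C.
apply/cvg_ex; exists (inf S); apply/cvgrPdist_le => /= e e0.
have upper : \forall j \near tails (@folner_le R G F),
    h (F j) <= (inf S + e) * #|` F j|%:R.
  have [s [K [delta [delta0 bound]]] se] := inf_adherent e0 infS.
  apply: filterS (folner_almost_invariant F K delta0) => j invj.
  apply: le_trans (bound _ (folner_nonempty j) invj) _.
  by rewrite ler_pM2r ?folner_card_gt0// ltW.
suff lower : \forall j \near tails (@folner_le R G F),
    (inf S - e) * #|` F j|%:R <= h (F j).
  apply: filterS2 upper lower => j up lo; rewrite ler_norml.
  have := folner_card_gt0 j => cj.
  rewrite -ler_pdivrMr// in up; rewrite -ler_pdivlMr// in lo.
  by apply/andP; split; lra.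
apply: contrapT => frequently_small.
(* Every degree of invariance holds eventually along the net while the lower estimate does not, so
   some [F j] is as invariant as desired and violates the estimate. *)
have smallT K (delta : R) : 0 < delta -> exists T : {fset G}, [/\ T != fset0,
     almost_invariant K delta T & h T < (inf S - e) * #|` T|%:R].
  move=> delta0; apply: contrapT => noT; apply: frequently_small.
  apply: filterS (folner_almost_invariant F K delta0) => j invj.
  rewrite leNgt; apply/negP => small; apply: noT.
  by exists (F j); split => //; exact: folner_nonempty.
have infSe : 0 < inf S - e.
  have [T [T0 _ /(le_lt_trans (h_ge0 T))]] := smallT fset0 1 ltr01.
  by rewrite pmulr_lgt0// ltr0n cardfs_gt0.
(* The value [mu] lies halfway between [inf S - e] and [inf S], and [eps <= e / (2 mu)] gives
   [inf S - e <= (1 - eps) * mu], the form needed for [h T]. *)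
pose mu := inf S - e / 2.
pose eps := Num.min 2^-1 (e / 2 / mu).
have mu0 : 0 < mu by rewrite /mu; lra.
have eps0 : 0 < eps by rewrite lt_min invr_gt0 ltr0n !divr_gt0.
have eps_half : eps <= 2^-1 by rewrite ge_min lexx.
have eps_mu : eps * mu <= e / 2 by rewrite -ler_pdivlMr// ge_min lexx orbT.
(* This makes [mu + C * eta <= inf S - e / 4]; [C + 1] keeps the denominator positive when
   [C = 0]. *)
pose eta := e / (4 * (C + 1)).
have C1 : 0 < C + 1 by lra.
have eta0 : 0 < eta by rewrite divr_gt0// mulr_gt0.
have Ceta : C * eta <= e / 4.
  have : (C + 1) * eta = e / 4 by rewrite /eta; field; rewrite gt_eqF.
  lra.
(* Since [s - mu >= e / 2], the improvement lowers [s] by at least [eps * e / 4], more than the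
   excess of [s] over [inf S]. Both terms of the maximum then fall below [inf S]. *)
have gap0 : 0 < eps * e / 8 by rewrite divr_gt0// mulr_gt0.
have [s Ss s_lt] := inf_adherent gap0 infS.
have s_ge : inf S <= s := ge_inf lbS Ss.
have smallT' K (delta : R) : 0 < delta -> exists T : {fset G},
    [/\ T != fset0, almost_invariant K delta T &
     h T <= (1 - eps) * mu * #|` T|%:R].
  move=> /(smallT K)[T [T0 invT /ltW hT]]; exists T; split => //.
  apply: le_trans hT _; rewrite ler_wpM2r//.
  by move: eps_mu; rewrite /mu; lra.
have mus : mu < s by rewrite /mu; lra.
have eps_int : 0 < eps <= 2^-1 by rewrite eps0.
have := ge_inf lbS (asymptotic_bound_improve h_sub h_rmul h_lin C0 (ltW mu0)
  mus eps_int eta0 smallT' Ss).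
rewrite le_max => /orP[]; last by rewrite /mu; lra.
have : eps * (e / 2) <= eps * (s - mu).
  by rewrite ler_pM2l// /mu; lra.
lra.
Qed.

(** * Iterated covers as covers by cylinders of words *)

Definition cylinder (G : groupType) (X : topologicalType)
    (a : continuous_action G X) (F : {fset G}) (w : G -> set X) : set X :=
  [set x | forall g, g \in F -> w g (a g x)].

(* The members of [cover_iter a alpha F] are the cylinders of words with
   letters in [alpha], so [cover_number] is the least number of words whose
   cylinders cover the space. *)
Definition word_cover (G : groupType) (X : topologicalType)
    (a : continuous_action G X) (alpha : {fset set X}) (F : {fset G})
    (n : nat) : Prop :=
  exists (I : finType) (w : I -> G -> set X),
    [/\ #|I| = n, forall i g, g \in F -> w i g \in alpha &
     forall x, exists i, cylinder a F (w i) x].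

Lemma cover_iterP (G : groupType) (X : topologicalType)
    (a : continuous_action G X) (alpha : {fset set X}) (F : {fset G})
    (A : set X) :
  A \in cover_iter a alpha F <->
  exists w, (forall g, g \in F -> w g \in alpha) /\ A = cylinder a F w.
Proof.
have := fset_uniq F; rewrite /cover_iter /cylinder.
(* In a duplicate-free enumeration, the letter at the head can be changed without affecting the word
   on the tail. *)
suff seqP (s : seq G) B : uniq s ->
    B \in \big[@cover_join X/[fset [set: X]]]_(g <- s) cover_pull a g alpha <->
    exists w, (forall g, g \in s -> w g \in alpha) /\
      B = [set x | forall g, g \in s -> w g (a g x)] by exact: seqP.
elim: s B => [|g s IH] {}A /=.
  move=> _; rewrite big_nil inE; split=> [/eqP->|[w [_ ->]]].
    exists (fun=> setT); split=> [g|]; first by rewrite in_nil.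
    apply/esym; rewrite -subTset => x _ g.
    by rewrite in_nil.
  by apply/eqP; rewrite -subTset => x _ g; rewrite in_nil.
move=> /andP[gs /IH{}IH]; rewrite big_cons; split.
  move=> /imfset2P[_ /imfsetP[B /= Balpha ->] [D /IH[w [walpha ->]] ->]].
  exists (fun k => if k == g then B else w k); split=> [k|].
    by rewrite inE; case: eqP => //= _; exact: walpha.
  rewrite predeqE => x; split=> [[Bx wx] k|wx].
    by rewrite inE; case: eqP => [->|_ /= /wx].
  split=> [|k ks]; first by have := wx g; rewrite inE eqxx; exact.
  have := wx k; rewrite inE ks orbT => /(_ isT).
  by case: eqP => // kg; rewrite kg (negPf gs) in ks.
move=> [w [walpha ->]]; apply/imfset2P.
exists (a g @^-1` w g).
  by apply/imfsetP; exists (w g) => //=; apply: walpha; rewrite inE eqxx.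
exists [set x | forall k, k \in s -> w k (a k x)].
  by apply/IH; exists w; split => // k ks; apply: walpha; rewrite inE ks orbT.
rewrite predeqE => x; split=> [wx|[wgx wx] k].
  by split=> [|k ks]; apply: wx; rewrite inE ?eqxx// ks orbT.
by rewrite inE => /orP[/eqP->|/wx].
Qed.

Lemma is_cover_exists (X : Type) (alpha : {fset set X}) :
  is_cover alpha -> forall x, exists2 A, A \in alpha & A x.
Proof.
by move=> cov x; have : [set: X] x by []; rewrite -cov => -[A]; exists A.
Qed.

Lemma is_cover_iter (G : groupType) (X : topologicalType)
    (a : continuous_action G X) (alpha : {fset set X}) (F : {fset G}) :
  is_cover alpha -> is_cover (cover_iter a alpha F).
Proof.
move=> /is_cover_exists cov; rewrite /is_cover -subTset => x _.
have /choice[w wP] g : exists A, A \in alpha /\ A (a g x).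
  by have [A] := cov (a g x); exists A.
exists (cylinder a F w); last by move=> g _; case: (wP g).
by apply/cover_iterP; exists w; split=> // g _; case: (wP g).
Qed.

Lemma cover_number_le (X : Type) (alpha beta : {fset set X}) :
  beta `<=` alpha -> is_cover beta -> (cover_number alpha <= #|` beta|)%N.
Proof.
move=> sub cov; rewrite /cover_number.
have : beta \in enum_fset (fpowerset alpha) by rewrite fpowersetE.
elim: (enum_fset _) => // g s IH; rewrite inE big_cons.
move=> /orP[/eqP<-|/IH le_beta]; first by rewrite asboolT// geq_minl.
by case: ifP => // _; rewrite geq_min le_beta orbT.
Qed.

Lemma cover_number_attained (X : Type) (alpha : {fset set X}) :
  is_cover alpha -> exists beta, [/\ beta `<=` alpha, is_cover beta &
    #|` beta| = cover_number alpha].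
Proof.
move=> cov; rewrite /cover_number big_seq_cond.
elim/big_rec: _ => [|beta n]; first by exists alpha.
rewrite fpowersetE => /andP[sub /asboolP cov_beta] n_attained.
by rewrite /minn; case: ifP => // _; exists beta.
Qed.

Lemma word_cover_number (G : groupType) (X : topologicalType)
    (a : continuous_action G X) (alpha : {fset set X}) (F : {fset G}) :
  is_cover alpha -> word_cover a alpha F (cover_number (cover_iter a alpha F)).
Proof.
move=> /(is_cover_iter a F)/cover_number_attained[beta [sub cov <-]].
have /choice[w wP] (A : beta) : exists w,
    (forall g, g \in F -> w g \in alpha) /\ fsval A = cylinder a F w.
  exact/cover_iterP/(fsubsetP sub)/fsvalP.
exists beta, w; split=> [|A g /(proj1 (wP A))//|x]; first by rewrite cardfE.
have [A Abeta Ax] := is_cover_exists cov x.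
by exists [` Abeta]; have [_ /= <-] := wP [` Abeta].
Qed.

Lemma cover_number_le_words (G : groupType) (X : topologicalType)
    (a : continuous_action G X) (alpha : {fset set X}) (F : {fset G})
    (n : nat) :
  word_cover a alpha F n -> (cover_number (cover_iter a alpha F) <= n)%N.
Proof.
move=> [I [w [<- walpha cov]]].
pose beta := [fset cylinder a F (w i) | i in I].
have sub : beta `<=` cover_iter a alpha F.
  apply/fsubsetP => _ /imfsetP[i _ ->]; apply/cover_iterP.
  by exists (w i); split=> // g; exact: walpha.
have cov_beta : is_cover beta.
  rewrite /is_cover -subTset => x _; have [i xi] := cov x.
  by exists (cylinder a F (w i)) => //=; apply/imfsetP; exists i.
apply: leq_trans (cover_number_le sub cov_beta) _.
by apply: leq_trans (leq_imfset_card _ _ _) _; rewrite /= -cardE.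
Qed.

(** Two words are glued by following the first on [A] and the second elsewhere. Taking logarithms
    turns this product into subadditivity. *)
Lemma word_coverU (G : groupType) (X : topologicalType)
    (a : continuous_action G X) (alpha : {fset set X}) (A B : {fset G})
    (m n : nat) :
  word_cover a alpha A m -> word_cover a alpha B n ->
  word_cover a alpha (A `|` B) (m * n).
Proof.
move=> [I [v [<- valpha vcov]]] [J [w [<- walpha wcov]]].
exists (I * J)%type, (fun ij g => if g \in A then v ij.1 g else w ij.2 g).
split=> [|[i j] g|x]; first by rewrite card_prod.
  by rewrite inE; case: ifP => [/valpha//|_ /walpha].
have [i vx] := vcov x; have [j wx] := wcov x; exists (i, j) => g /=.
by rewrite inE; case: ifP => [/vx//|_ /wx].
Qed.

(** Reading [x] along [F c] is reading [c x] along [F]. *)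
Lemma word_cover_rmul (G : groupType) (X : topologicalType)
    (a : continuous_action G X) (alpha : {fset set X}) (F : {fset G}) (c : G)
    (n : nat) :
  word_cover a alpha F n -> word_cover a alpha (fset_rmul F c) n.
Proof.
move=> [I [w [<- walpha wcov]]]; exists I, (fun i g => w i (g * c^-1)%g).
split=> // [i g|x]; first by rewrite in_fset_rmul => /walpha.
have [i wx] := wcov (a c x); exists i => g; rewrite in_fset_rmul => /wx.
by rewrite -act_mul mulgVK.
Qed.

Lemma word_cover_letters (G : groupType) (X : topologicalType)
    (a : continuous_action G X) (alpha : {fset set X}) (F : {fset G}) :
  is_cover alpha -> word_cover a alpha F (#|` alpha| ^ #|` F|)%N.
Proof.
move=> /is_cover_exists cov; elim/fset1U_rect: F => [|g F gF IH].
  exists unit, (fun _ _ => setT); split=> [|i g|x].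
  - by rewrite card_unit cardfs0.
  - by rewrite inE.
  - by exists tt => g; rewrite inE.
rewrite cardfsU1 gF expnS; apply: word_coverU => //.
exists alpha, (fun A _ => fsval A); split=> [|A k _|x].
- by rewrite cardfE.
- exact: fsvalP.
- have [A Aalpha Ax] := cov (a g x).
  by exists [` Aalpha] => k; rewrite inE => /eqP->.
Qed.

Lemma word_cover_gt0 (G : groupType) (X : topologicalType)
    (a : continuous_action G X) (alpha : {fset set X}) (F : {fset G})
    (n : nat) (x : X) :
  word_cover a alpha F n -> (0 < n)%N.
Proof. by move=> [I [w [<- _ /(_ x)[i _]]]]; apply/card_gt0P; exists i. Qed.

Lemma cvg_htop_cover (R : realType) (G : groupType) (X : topologicalType)
    (a : continuous_action G X) (alpha : {fset set X})
    (F : left_folner_net R G) (x : X) :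
  is_cover alpha ->
  cvg ((ln (cover_number (cover_iter a alpha (F j)))%:R / #|` F j|%:R : R)
         @[j --> tails (@folner_le R G F)]).
Proof.
move=> cov.
have words A := word_cover_number a A cov.
have pos A : (1 <= (cover_number (cover_iter a alpha A))%:R :> R).
  by rewrite ler1n (word_cover_gt0 x (words A)).
have pos0 A := lt_le_trans ltr01 (pos A).
apply: (@ornstein_weiss _ _ _
  (fun A => ln (cover_number (cover_iter a alpha A))%:R)
  (ln #|` alpha|%:R)) => [A B|A c|A|A].
- rewrite -lnM ?posrE// -natrM ler_ln ?posrE// ?ler_nat; last first.
    by rewrite natrM mulr_gt0.
  exact/cover_number_le_words/word_coverU.
- rewrite ler_ln ?posrE// ler_nat.
  exact/cover_number_le_words/word_cover_rmul.
- exact: ln_ge0.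
- have [A0 A0alpha _] := is_cover_exists cov x.
  have alpha0 : 0 < #|` alpha|%:R :> R.
    by rewrite ltr0n cardfs_gt0; apply/fset0Pn; exists A0.
  rewrite mulr_natr -lnXn// -natrX ler_ln ?posrE// ?natrX ?exprn_gt0//.
  rewrite -natrX ler_nat.
  exact/cover_number_le_words/word_cover_letters.
Qed.

(** * Separated subsets and patterns realized by specification *)

(** Greedy choice: pick [e], discard all points in conflict with it, and recurse on the rest. *)
Lemma exists_separated_subset (G : groupType) (L F : {fset G}) :
  exists E : {fset G}, [/\ E `<=` F,
    forall e e', e \in E -> e' \in E -> e != e' ->
      e \notin fset_mul L [fset e'] &
    (#|` F| <= (1 + 2 * #|` L|) * #|` E|)%N].
Proof.
elim/finSet_rect: F => F IH.
have [->|[e eF]] := fset_0Vmem F.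
  by exists fset0; split => //; rewrite cardfs0.
(* Separation is required in both orders, so both [L e] and [L^-1 e] are discarded: at most
   [1 + 2 |L|] points together with [e]. *)
pose N := e |` fset_rmul L e `|` [fset (l^-1 * e)%g | l in L].
have eN : e \in N by rewrite !inE eqxx.
have [|E [sub sep card]] := IH (F `\` N).
  rewrite fproperE fsubsetDl /=; apply/fsubsetPn; exists e => //.
  by rewrite inE eN.
have subF : E `<=` F by apply: fsubset_trans sub (fsubsetDl _ _).
have notN f : f \in E -> f \notin N.
  by move=> /(fsubsetP sub); rewrite inE => /andP[].
exists (e |` E); split.
- by rewrite fsubUset fsub1set eF.
- move=> f f'; rewrite !inE => /orP[/eqP->|fE] /orP[/eqP->|f'E] neq.
  + by rewrite eqxx in neq.
  + apply/negP => /imfset2P[l lL [_ /fset1P-> /= ef']].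
    move: (notN _ f'E); rewrite !inE => /norP[_ /imfsetP]; apply.
    by exists l => //=; rewrite ef' mulKg.
  + apply/negP => /imfset2P[l lL [_ /fset1P-> /= fe]].
    move: (notN _ fE); rewrite !inE in_fset_rmul fe mulgK => /norP[/norP[_]].
    by rewrite lL.
  + exact: sep.
- rewrite cardfsU1 (contraL (notN e)) ?eN//.
  rewrite -(cardfsID N F) mulnDr muln1 leq_add//.
  apply: leq_trans (fsubset_leq_card (fsubsetIr _ _)) _.
  rewrite cardfsU; apply: leq_trans (leq_subr _ _) _.
  rewrite mul2n -addnn addnA leq_add//; last exact: leq_imfset_card.
  rewrite cardfsU1 card_fset_rmul leq_add2r; exact: leq_b1.
Qed.

Lemma exists_separating_cover (X : topologicalType) (x y : X) :
  compact [set: X] -> hausdorff_space X -> x <> y ->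
  exists (A B : set X) (U : set (X * X)),
    [/\ finite_open_cover [fset A; B], diag_entourage U,
     forall z, U (z, x) -> ~ A z & forall z, U (z, y) -> ~ B z].
Proof.
move=> cX hX xy.
have xny : x != y by apply/eqP.
move: (hX); rewrite open_hausdorff => /(_ _ _ xny).
move=> [[P Q] /= [xP yQ] [oP oQ /eqP PQ0]].
rewrite !inE in xP yQ.
have regular (p : X) (O : set X) : open O -> O p ->
    exists V, [/\ open V, V p & closure V `<=` O]%classic.
  move=> oO Op.
  have [V pV VO] := compact_regular hX cX (@filterT _ (nbhs p) _)
    (open_nbhs_nbhs (conj oO Op)).
  exists (interior V); split; [exact: open_interior|exact: pV|].
  by apply: subset_trans VO; apply: closureS; exact: interior_subset.
have [V [oV Vx VP]] := regular x P oP xP.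
have [W [oW Wy WQ]] := regular y Q oQ yQ.
exists (~` closure V)%classic, (~` closure W)%classic.
(* This set constrains only pairs whose second coordinate is [x] or [y], the only targets used in
   shadowing. *)
exists [set zp | (zp.2 = x -> V zp.1) /\ (zp.2 = y -> W zp.1)]; split.
- split=> [A|].
    by rewrite !inE => /orP[/eqP->|/eqP->]; exact/closed_openC/closed_closure.
  rewrite /is_cover -subTset => z _.
  have [/VP Pz|nVz] := pselect (closure V z); last first.
    by exists (~` closure V)%classic => //=; rewrite !inE eqxx.
  exists (~` closure W)%classic => /=; first by rewrite !inE eqxx orbT.
  by move=> /WQ Qz; have : set0 z by rewrite -PQ0.
- move=> [p p'] /= ->.
  (* Away from [q] the condition is vacuous near the diagonal, as points are closed; at [q] the
     neighborhood [O] suffices. *)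
  have near_diag q (O : set X) : open O -> O q ->
      nbhs (p', p') [set zp : X * X | zp.2 = q -> O zp.1].
    move=> oO Oq; have [->|qp] := pselect (p' = q).
      exists (O, setT) => [|[z w] [/= Oz _] _ //].
      by split; [exact: open_nbhs_nbhs|exact: filterT].
    have oq : open (~` [set q])%classic.
      exact/closed_openC/accessible_closed_set1/hausdorff_accessible.
    exists (setT, ~` [set q])%classic => [|[z w] [_ /= wq] /wq //].
    by split; [exact: filterT|exact: open_nbhs_nbhs].
  by apply: filterI; exact: near_diag.
- by move=> z /= [/(_ erefl) Vz _]; apply; exact: subset_closure.
- by move=> z /= [_ /(_ erefl) Wz]; apply; exact: subset_closure.
Qed.

(** Each of the [2 ^ |E|] patterns of [x] and [y] on [E] is shadowed by a point. A word containing
    that point must avoid [A] where the pattern has [x] and [B] where it has [y], so with only two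
    letters it determines the pattern. *)
Lemma specification_lower_bound (G : groupType) (X : topologicalType)
    (a : continuous_action G X) (x y : X) :
  compact [set: X] -> hausdorff_space X -> x <> y -> weak_specification a ->
  exists (alpha : {fset set X}) (L : {fset G}),
    finite_open_cover alpha /\ forall (F E : {fset G}) n, E `<=` F ->
      (forall e e', e \in E -> e' \in E -> e != e' ->
         e \notin fset_mul L [fset e']) ->
      word_cover a alpha F n -> (2 ^ #|` E| <= n)%N.
Proof.
move=> cX hX xy spec.
have [A [B [U [cov entU UA UB]]]] := exists_separating_cover cX hX xy.
have [L specL] := spec U entU.
exists [fset A; B], L; split=> // F E n EF sep words.
(* Specification applies only to nonempty sequences. *)
have [->|E0] := eqVneq E fset0.
  by rewrite cardfs0 expn0 (word_cover_gt0 x words).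
have shadow (f : {ffun E -> bool}) : exists z, forall e : E,
    U (a (fsval e) z, if f e then x else y).
  (* The windows are the singletons of [E]; the point to be followed at [e] is [e^-1 x] or [e^-1 y],
     which [e] carries to [x] or [y]. *)
  have [||z zP] := specL #|{: E}| (fun i => [fset fsval (enum_val i)])
    (fun i => a (fsval (enum_val i))^-1%g (if f (enum_val i) then x else y)).
  - by rewrite -cardfE cardfs_gt0.
  - move=> j k jk; apply/eqP; rewrite fsetI_eq0 fdisjoint1X; apply: sep => //.
    by apply: contra_neq jk => /val_inj/enum_val_inj.
  - exists z => e; have := zP (enum_rank e) (fsval e).
    rewrite !enum_rankK inE eqxx => /(_ isT).
    by rewrite -act_mul mulgV act_one.
case: words => I [w [<- walpha wcov]].
have /choice[i iP] (f : {ffun E -> bool}) : exists i, forall e : E,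
    w i (fsval e) \in [fset A; B] /\ w i (fsval e) <> if f e then A else B.
  have [z zP] := shadow f; have [i zi] := wcov z; exists i => e.
  have eF : fsval e \in F by apply/(fsubsetP EF)/fsvalP.
  split=> [|we]; first exact: walpha.
  by have := zi _ eF; have := zP e; rewrite we; case: (f e) => [/UA|/UB].
have i_inj : injective i.
  move=> f f' ff'; apply/ffunP => e; have [_] := iP f e.
  have [] := iP f' e; rewrite ff' !inE => /orP[]/eqP->.
    by case: (f e); case: (f' e).
  by case: (f e); case: (f' e).
have := leq_card i i_inj; rewrite card_ffun card_bool -cardfE; exact.
Qed.

(** * Positivity of the entropy *)

Lemma htop_cover_gt0 (R : realType) (G : groupType) (X : topologicalType)
    (a : continuous_action G X) (x y : X) (F : left_folner_net R G) :
  compact [set: X] -> hausdorff_space X -> x <> y -> weak_specification a ->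
  exists alpha, finite_open_cover alpha /\ 0 < htop_cover F a alpha.
Proof.
move=> cX hX xy spec.
have [alpha [L [cov lower]]] := specification_lower_bound cX hX xy spec.
exists alpha; split => //.
(* The rate combines [2 ^ |E| <= N] with [|F j| <= (1 + 2 |L|) * |E|]. *)
pose c : R := ln 2 / (1 + 2 * #|` L|)%N%:R.
have c0 : 0 < c by rewrite divr_gt0 ?ln_gt0// ltr1n.
(* The eventual lower bound passes to [lim] because the Ornstein-Weiss lemma guarantees
   convergence. *)
apply: lt_le_trans c0 _; apply: limr_ge.
  exact: cvg_htop_cover F x (proj2 cov).
near=> j; have [E [EF sep card]] := exists_separated_subset L (F j).
rewrite ler_pdivlMr ?folner_card_gt0//.
have := lower _ _ _ EF sep (word_cover_number a (F j) (proj2 cov)).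
move=> N_ge; apply: (@le_trans _ _ (ln (2 ^ #|` E|)%N%:R)).
  rewrite natrX lnXn// -[leRHS]mulr_natr /c mulrAC ler_pdivrMr//.
  by rewrite -mulrA ler_wpM2l ?ln_ge0 ?ler1n// -natrM ler_nat mulnC.
rewrite ler_ln ?posrE ?ltr0n ?expn_gt0// ?ler_nat//.
by apply: leq_trans N_ge; rewrite expn_gt0.
Unshelve. all: by end_near.
Qed.

Theorem theorem6p8 (R : realType) (G : groupType) (X : topologicalType)
    (X_compact : compact [set: X]) (X_hausdorff : hausdorff_space X)
    (a : continuous_action G X) (G_amenable : amenable R G)
    (X_nontrivial : exists x y : X, x <> y)
    (a_spec : weak_specification a) :
  forall F : left_folner_net R G, (0%:E < htop F a)%E.
Proof.
move=> F; have [x [y xy]] := X_nontrivial.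
have [alpha [cov pos]] := htop_cover_gt0 F X_compact X_hausdorff xy a_spec.
apply: (@lt_le_trans _ _ (htop_cover F a alpha)%:E); first by rewrite lte_fin.
by apply: ereal_sup_ubound; exists alpha.
Qed.
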